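(* Assume that $g:\mathbb{R}^d\to\mathbb{R}\cup\{+\infty\}$ is the indicator function of a simple convex set $\mathcal{K}\subset\mathbb{R}^d$. Then the sequence $x_k$ generated by the composite conditional gradient algorithm described in the context satisfies: $$f(x_k)-f^\star\;\ge\;-\|y^\star\|\,\mathrm{dist}(Ax_k,\mathcal{K}),$$ $$f(x_k)-f^\star\;\le\;2D_{\mathcal{X}}^2\left(\frac{L_f}{k}+\frac{\|A\|^2}{\beta_0\sqrt{k}}\right),$$ $$\mathrm{dist}(Ax_k,\mathcal{K})\;\le\;\frac{2\beta_0}{\sqrt{k}}\left(\|y^\star\|+D_{\mathcal{X}}\sqrt{\frac{C_0}{\beta_0}}\right),$$ where $C_0=L_f+\|A\|^2/\beta_0$.
   Context: Problem: $\min_{x\in\mathcal{X}} F(x) := f(x)+g(Ax)$, where $\mathcal{X}\subset\mathbb{R}^n$ is nonempty, compact and convex; $f$ is a proper closed convex function, differentiable on $\mathcal{X}$ and $L_f$-smooth, i.e. $\|\nabla f(x)-\nabla f(x')\|\le L_f\|x-x'\|$ for all $x,x'\in\mathcal{X}$; $A\in\mathbb{R}^{d\times n}$; and $g$ is proper, closed, convex (so $\mathcal{K}$ is nonempty and closed). Norms of vectors are Euclidean, $\|A\|$ is the spectral norm, and $\mathrm{dist}(z,\mathcal{K})$ is the Euclidean distance from $z$ to $\mathcal{K}$. The indicator function of $\mathcal{K}$ is $0$ on $\mathcal{K}$ and $+\infty$ elsewhere; ''simple'' means that the projection onto $\mathcal{K}$ is tractable. The set of minimizers is assumed nonempty; $x^\star$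 is a minimizer and $f^\star=f(x^\star)$. $D_{\mathcal{X}}=\max_{x,x'\in\mathcal{X}}\|x-x'\|$. Also $\mathrm{prox}_{\phi}(v)=\arg\min_x \phi(x)+\frac12\|x-v\|^2$; for $g$ the indicator of $\mathcal{K}$, $\mathrm{prox}_{\beta g}$ is the projection onto $\mathcal{K}$. Duality: with $g^*(y)=\sup_v\langle y,v\rangle-g(v)$ and $\mathcal{L}(x,y)=f(x)+\langle y,Ax\rangle-g^*(y)$, strong duality is assumed: $\max_{y\in\mathbb{R}^d}\min_{x\in\mathcal{X}}\mathcal{L}(x,y)=\min_{x\in\mathcal{X}}\max_{y\in\mathbb{R}^d}\mathcal{L}(x,y)$; $y^\star$ denotes a solution of the dual problem $\max_{y}\min_{x\in\mathcal{X}}\mathcal{L}(x,y)$. Algorithm: given $x_1\in\mathcal{X}$, $\beta_0>0$, for $k=1,2,\dots$ set $\eta_k=\frac{2}{k+1}$, $\beta_k=\frac{\beta_0}{\sqrt{k+1}}$, $v_k=\beta_k\nabla f(x_k)+A^\top\big(Ax_k-\mathrm{prox}_{\beta_k g}(Ax_k)\big)$, $s_k\in\arg\min_{x\in\mathcal{X}}\langle v_k,x\rangle$, and $x_{k+1}=x_k+\eta_k(s_k-x_k)$.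
   Formalization: The upper bound on f(x_k) − f* is stated only for k ≥ 2, since it fails at the arbitrary starting point x_1 (e.g. X=[0,1], f(x)=x, L_f=0, A=0, K={0}, x_1=1); the other two bounds hold for all k ≥ 1. *)

(* Defs.v *)
From mathcomp Require Import all_boot all_order all_algebra.
From mathcomp Require Import all_classical all_reals all_analysis.
Import Order.TTheory GRing.Theory Num.Theory.
Import numFieldNormedType.Exports.

Set Implicit Arguments.
Unset Strict Implicit.
Unset Printing Implicit Defensive.

Local Open Scope classical_set_scope.
Local Open Scope ring_scope.

(* The library norm `|u| on matrices is the max norm, hence the Euclidean norm,
   and the operator norm it induces, are defined here. The topology (and thus
   compactness, semicontinuity and differentiability) is the same for both. *)
Definition dotp (R : realType) n (u v : 'cV[R]_n) : R :=
  \sum_(i < n) u i 0 * v i 0.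

Definition enorm (R : realType) n (u : 'cV[R]_n) : R := Num.sqrt (dotp u u).

Definition spectral_norm (R : realType) d n (A : 'M[R]_(d, n)) : R :=
  sup [set enorm (A *m u) | u in [set u : 'cV[R]_n | enorm u <= 1]].

Definition dist (R : realType) n (z : 'cV[R]_n) (K : set 'cV[R]_n) : R :=
  inf [set enorm (z - w) | w in K].

Definition diameter (R : realType) n (X : set 'cV[R]_n) : R :=
  sup [set enorm (p.1 - p.2) | p in X `*` X].

Definition is_argmin T disp (U : porderType disp) (D : set T) (phi : T -> U)
    (x : T) : Prop :=
  D x /\ forall y, D y -> (phi x <= phi y)%O.

Definition is_argmax T disp (U : porderType disp) (D : set T) (phi : T -> U)
    (x : T) : Prop :=
  D x /\ forall y, D y -> (phi y <= phi x)%O.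

Definition proper (R : realType) T (f : T -> \bar R) : Prop :=
  (forall x, f x != -oo%E) /\ exists x, f x != +oo%E.

(* Only meaningful for functions avoiding -oo; recall that 0 * +oo = 0. *)
Definition convex_efun (R : realType) (E : lmodType R) (f : E -> \bar R) : Prop :=
  forall (x y : E) (t : R), 0 <= t <= 1 ->
    (f (t *: x + (1 - t) *: y)%R
       <= t%:E * f x + (1 - t)%:E * f y)%E.

Definition proper_closed_convex (R : realType) n (f : 'cV[R]_n -> \bar R) : Prop :=
  [/\ proper f, lower_semicontinuous f & convex_efun f].

Definition indicator (R : realType) T (K : set T) (z : T) : \bar R :=
  if z \in K then 0%E else +oo%E.

(* Since fine maps +oo to 0, finiteness near x has to be required separately. *)
Definition edifferentiable (R : realType) n (f : 'cV[R]_n -> \bar R)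
    (x : 'cV[R]_n) : Prop :=
  (\forall z \near x, f z \is a fin_num) /\ differentiable (fine \o f) x.

Definition gradient (R : realType) n (f : 'cV[R]_n -> \bar R) (x : 'cV[R]_n) :
    'cV[R]_n :=
  \col_(i < n) 'D_(delta_mx i 0) (fine \o f) x.

Definition smooth_on (R : realType) n (X : set 'cV[R]_n)
    (f : 'cV[R]_n -> \bar R) (L : R) : Prop :=
  (forall x, X x -> edifferentiable f x) /\
  (forall x x', X x -> X x' ->
     enorm (gradient f x - gradient f x') <= L * enorm (x - x')).

Definition is_prox (R : realType) n (phi : 'cV[R]_n -> \bar R)
    (v p : 'cV[R]_n) : Prop :=
  is_argmin setT (fun w => phi w + (2^-1 * enorm (w - v) ^+ 2)%:E)%E p.

Definition objective (R : realType) d n (f : 'cV[R]_n -> \bar R)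
    (g : 'cV[R]_d -> \bar R) (A : 'M[R]_(d, n)) (x : 'cV[R]_n) : \bar R :=
  (f x + g (A *m x))%E.

Definition conjugate (R : realType) d (g : 'cV[R]_d -> \bar R) (y : 'cV[R]_d) :
    \bar R :=
  ereal_sup (range (fun v => ((dotp y v)%:E - g v)%E)).

Definition lagrangian (R : realType) d n (f : 'cV[R]_n -> \bar R)
    (g : 'cV[R]_d -> \bar R) (A : 'M[R]_(d, n)) (x : 'cV[R]_n) (y : 'cV[R]_d) :
    \bar R :=
  (f x + (dotp y (A *m x))%:E - conjugate g y)%E.

Definition dual_function (R : realType) d n (X : set 'cV[R]_n)
    (f : 'cV[R]_n -> \bar R) (g : 'cV[R]_d -> \bar R) (A : 'M[R]_(d, n))
    (y : 'cV[R]_d) : \bar R :=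
  ereal_inf [set lagrangian f g A x y | x in X].

(* Extrema are taken in \bar R: the inner maximum over y is +oo, and is not
   attained, when A x is outside the domain of g. *)
Definition strong_duality (R : realType) d n (X : set 'cV[R]_n)
    (f : 'cV[R]_n -> \bar R) (g : 'cV[R]_d -> \bar R) (A : 'M[R]_(d, n)) : Prop :=
  ereal_sup (range (dual_function X f g A)) =
  ereal_inf [set ereal_sup (range (lagrangian f g A x)) | x in X].

(* The iterates are x 1, x 2, ...; the value x 0 is irrelevant. *)
Definition composite_cg (R : realType) d n (X : set 'cV[R]_n)
    (f : 'cV[R]_n -> \bar R) (g : 'cV[R]_d -> \bar R) (A : 'M[R]_(d, n))
    (beta0 : R) (x : nat -> 'cV[R]_n) : Prop :=
  X (x 1%N) /\
  forall k : nat, (1 <= k)%N ->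
    let eta := 2 / k.+1%:R in
    let beta := beta0 / Num.sqrt k.+1%:R in
    exists (p : 'cV[R]_d) (s : 'cV[R]_n),
      let v := beta *: gradient f (x k) + A^T *m (A *m x k - p) in
      [/\ is_prox (fun z => beta%:E * g z)%E (A *m x k) p,
          is_argmin X (dotp v) s &
          x k.+1 = x k + eta *: (s - x k)].

(* Main.v *)
Require Import Defs.
From mathcomp Require Import all_boot all_order all_algebra.
From mathcomp Require Import all_classical all_reals all_analysis.
From mathcomp Require Import ring lra.
Import Order.TTheory GRing.Theory Num.Theory.
Import numFieldNormedType.Exports.

Set Implicit Arguments.
Unset Strict Implicit.
Unset Printing Implicit Defensive.

Local Open Scope classical_set_scope.
Local Open Scope ring_scope.

(** Write F_b(z) = f(z) + dist(Az, K)^2 / (2b) for the objective in which the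
constraint Az \in K is replaced by a quadratic penalty, beta_k = beta0 /
sqrt(k+1) and eta_k = 2 / (k+1).  The direction v_k of the algorithm is
beta_k times the gradient of F_{beta_k} at x_k, so each iteration is a
Frank-Wolfe step on a function which is smooth with constant
Lf + ||A||^2 / beta_k.

One step ([smoothed_gap_step]).  The descent lemma for f and the inequality
dist(z', K) <= ||z' - p||, where p is the projection of z = A x_k, bound
F_{beta_k}(x_{k+1}) by its linear model at x_k plus a curvature term.  The
linear model is minimized over X by s_k, hence is at most its value at xstar.
There convexity of f gives f(xstar) - f(x_k), and the obtuse-angle property of
the projection gives not merely the usual -dist^2 / (2 beta_k) but twice as
much, because A xstar lies in K and so has distance zero.

The rate ([smoothed_gap_rate]).  That extra factor pays for the decrease of the
penalty parameter: dist^2 gets the weight (1 - 2 eta_k) / beta_k, which is at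
most (1 - eta_k) / beta_{k-1}.  Hence S_k = F_{beta_{k-1}}(x_k) - f(xstar)
satisfies S_{k+1} <= (1 - eta_k) S_k + O(eta_k^2 / beta_k), whose solution is
S_k <= 2 D^2 (Lf / k + ||A||^2 / (beta0 sqrt k)) for k >= 2; the starting value
S_1 is forgotten since eta_1 = 1.  As S_k dominates f(x_k) - f(xstar), this is
the upper bound.

Duality ([saddle_point]).  Strong duality turns ystar into a linear minorant,
f(x) - f(xstar) >= <ystar, v - Ax> for x in X and v in K, and Cauchy-Schwarz
gives the lower bound.  Extracting this from an equality between a supremum of
infima and an infimum of suprema requires the primal side to be the objective
itself, that is g** >= g for the indicator of K; this is the separation of a
point from K, done with the projection ([objective_le_sup_lagrangian]).

Feasibility.  Inserting the lower bound in the rate leaves a quadratic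
inequality in dist(A x_k, K) ([quadratic_distance_bound]).  For k = 1 the
distance is at most ||A|| ||x_1 - xstar||, which the stated bound dominates.

A negative Lf is possible, but only if X is a single point; then D = 0, and
[lipschitz_diameter] keeps the products Lf D^2 under control in all cases. *)

(** * Inner product and Euclidean norm *)

Lemma dotpE (R : realType) n (u v : 'cV[R]_n) : dotp u v = (u^T *m v) 0 0.
Proof. by rewrite mxE; apply: eq_bigr => i _; rewrite mxE. Qed.

Lemma dotpC (R : realType) n (u v : 'cV[R]_n) : dotp u v = dotp v u.
Proof. by apply: eq_bigr => i _; rewrite mulrC. Qed.

Lemma dotpDr (R : realType) n (u v w : 'cV[R]_n) :
  dotp u (v + w) = dotp u v + dotp u w.
Proof. by rewrite !dotpE mulmxDr mxE. Qed.

Lemma dotpZr (R : realType) n (a : R) (u v : 'cV[R]_n) :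
  dotp u (a *: v) = a * dotp u v.
Proof. by rewrite !dotpE -scalemxAr mxE. Qed.

Lemma dotpBr (R : realType) n (u v w : 'cV[R]_n) :
  dotp u (v - w) = dotp u v - dotp u w.
Proof. by rewrite dotpDr -scaleN1r dotpZr mulN1r. Qed.

Lemma dotpDl (R : realType) n (u v w : 'cV[R]_n) :
  dotp (u + v) w = dotp u w + dotp v w.
Proof. by rewrite !(dotpC _ w) dotpDr. Qed.

Lemma dotpBl (R : realType) n (u v w : 'cV[R]_n) :
  dotp (u - v) w = dotp u w - dotp v w.
Proof. by rewrite !(dotpC _ w) dotpBr. Qed.

Lemma dotpZl (R : realType) n (a : R) (u v : 'cV[R]_n) :
  dotp (a *: u) v = a * dotp u v.
Proof. by rewrite !(dotpC _ v) dotpZr. Qed.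

Lemma dotp_trmx (R : realType) d n (A : 'M[R]_(d, n)) u v :
  dotp (A^T *m u) v = dotp u (A *m v).
Proof. by rewrite !dotpE trmx_mul trmxK mulmxA. Qed.

Lemma dotp0l (R : realType) n (v : 'cV[R]_n) : dotp 0 v = 0.
Proof. by rewrite -(scale0r 0) dotpZl mul0r. Qed.

Lemma dotp_ge0 (R : realType) n (u : 'cV[R]_n) : 0 <= dotp u u.
Proof. by apply: sumr_ge0 => i _; rewrite -expr2 sqr_ge0. Qed.

Lemma dotp_eq0 (R : realType) n (u : 'cV[R]_n) : dotp u u = 0 -> u = 0.
Proof.
move=> u0; apply/colP => i; rewrite mxE.
have /psumr_eq0P/(_ u0)/(_ i isT)/eqP : forall i : 'I_n,
    true -> 0 <= u i 0 * u i 0 by move=> j _; rewrite -expr2 sqr_ge0.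
by rewrite mulf_eq0 orbb => /eqP.
Qed.

Lemma enorm_ge0 (R : realType) n (u : 'cV[R]_n) : 0 <= enorm u.
Proof. exact: sqrtr_ge0. Qed.

Lemma sqr_enorm (R : realType) n (u : 'cV[R]_n) : enorm u ^+ 2 = dotp u u.
Proof. by rewrite sqr_sqrtr // dotp_ge0. Qed.

Lemma enorm0 (R : realType) n : enorm (0 : 'cV[R]_n) = 0.
Proof. by rewrite /enorm dotp0l sqrtr0. Qed.

Lemma enorm_eq0 (R : realType) n (u : 'cV[R]_n) : enorm u = 0 -> u = 0.
Proof. by move=> u0; apply: dotp_eq0; rewrite -sqr_enorm u0 expr0n. Qed.

Lemma enormZ (R : realType) n (a : R) (u : 'cV[R]_n) :
  enorm (a *: u) = `|a| * enorm u.
Proof.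
by rewrite /enorm dotpZl dotpZr mulrA -expr2 sqrtrM ?sqr_ge0 // sqrtr_sqr.
Qed.

Lemma ler_enorm (R : realType) n m (u : 'cV[R]_n) (v : 'cV[R]_m) :
  (enorm u <= enorm v) = (dotp u u <= dotp v v).
Proof. by rewrite ler_sqrt // dotp_ge0. Qed.

Lemma enormB (R : realType) n (u v : 'cV[R]_n) : enorm (u - v) = enorm (v - u).
Proof. by rewrite -opprB -scaleN1r enormZ normrN1 mul1r. Qed.

(** Cauchy-Schwarz, from the square of ||v|| u - ||u|| v being nonnegative. *)
Lemma dotp_le_enorm (R : realType) n (u v : 'cV[R]_n) :
  dotp u v <= enorm u * enorm v.
Proof.
have [v0|v0] := eqVneq (enorm v) 0.
  by rewrite (enorm_eq0 v0) enorm0 mulr0 dotpC dotp0l.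
have vgt0 : 0 < enorm v by rewrite lt_neqAle eq_sym v0 enorm_ge0.
have := dotp_ge0 (enorm v *: u - enorm u *: v).
rewrite !(dotpBl, dotpBr, dotpZl, dotpZr) -!sqr_enorm (dotpC v u).
have [u0|u0] := eqVneq (enorm u) 0.
  by move=> _; rewrite (enorm_eq0 u0) dotp0l enorm0 mul0r.
have ugt0 : 0 < enorm u by rewrite lt_neqAle eq_sym u0 enorm_ge0.
have uv0 := mulr_gt0 ugt0 vgt0.
move=> H; rewrite -subr_ge0 -(pmulr_rge0 _ uv0).
by move: H; set a := enorm u; set b := enorm v; nra.
Qed.

Lemma dotp_continuous {R : realType} {T : topologicalType} {n}
    {F G : T -> 'cV[R]_n} :
  continuous F -> continuous G -> continuous (fun t => dotp (F t) (G t)).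
Proof.
move=> cF cG; apply: (@continuous_big R _ +%R 0 xpredT _ T (index_enum 'I_n)
  (fun i t => F t i 0 * G t i 0)); first exact: add_continuous.
move=> i _ t; apply: (@cvgM R).
  exact: (cvg_comp _ _ (cF t) (@coord_continuous _ _ _ i 0 _)).
exact: (cvg_comp _ _ (cG t) (@coord_continuous _ _ _ i 0 _)).
Qed.

(** * Spectral norm, diameter and distance *)

(** The Frobenius norm is an upper bound, row by row by Cauchy-Schwarz; without
an upper bound the supremum defining the spectral norm would carry no
information. *)
Lemma spectral_norm_ub {R : realType} {d n} (A : 'M[R]_(d, n)) :
  has_ubound [set enorm (A *m u) | u in [set u : 'cV[R]_n | enorm u <= 1]].
Proof.
exists (Num.sqrt (\sum_i enorm (row i A)^T ^+ 2)) => _ [u /= u1 <-].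
rewrite ler_sqrt; last by apply: sumr_ge0 => i _; exact: sqr_ge0.
apply: ler_sum => i _; rewrite -expr2 -[leRHS]mulr1.
have -> : (A *m u) i 0 = dotp (row i A)^T u.
  by rewrite dotpE trmxK -row_mul [RHS]mxE.
have h v : dotp (row i A)^T v <= enorm (row i A)^T * enorm v.
  exact: dotp_le_enorm.
have u0 := enorm_ge0 u; have a0 := enorm_ge0 (row i A)^T.
have /andP[hl hr] : - enorm (row i A)^T <= dotp (row i A)^T u <= enorm (row i A)^T.
  have := h u; have := h ((-1) *: u); rewrite dotpZr enormZ normrN1.
  by move=> hN hu; apply/andP; split; nra.
by rewrite mulr1; nra.
Qed.

Lemma spectral_norm_ge0 {R : realType} {d n} (A : 'M[R]_(d, n)) :
  0 <= spectral_norm A.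
Proof.
apply: ub_le_sup; first exact: spectral_norm_ub.
by exists 0; rewrite /= ?mulmx0 enorm0.
Qed.

Lemma enorm_mulmx {R : realType} {d n} (A : 'M[R]_(d, n)) u :
  enorm (A *m u) <= spectral_norm A * enorm u.
Proof.
have [u0|u0] := eqVneq (enorm u) 0.
  by rewrite u0 mulr0 (enorm_eq0 u0) mulmx0 enorm0.
have ugt0 : 0 < enorm u by rewrite lt_neqAle eq_sym u0 enorm_ge0.
rewrite -ler_pdivrMr // mulrC -[(enorm u)^-1]ger0_norm ?invr_ge0 ?enorm_ge0 //.
rewrite -enormZ scalemxAr; apply: ub_le_sup; first exact: spectral_norm_ub.
exists ((enorm u)^-1 *: u) => //=.
by rewrite enormZ ger0_norm ?invr_ge0 ?enorm_ge0 // mulVf.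
Qed.

Lemma dist_le {R : realType} {n} (z w : 'cV[R]_n) (K : set 'cV[R]_n) :
  K w -> dist z K <= enorm (z - w).
Proof.
move=> Kw; apply: ge_inf; last by exists w.
by exists 0 => _ [v _ <-]; exact: enorm_ge0.
Qed.

Lemma dist_ge {R : realType} {n} (z : 'cV[R]_n) (K : set 'cV[R]_n) (c : R) :
  K !=set0 -> (forall w, K w -> c <= enorm (z - w)) -> c <= dist z K.
Proof.
move=> [w Kw] h; apply: lb_le_inf; first by exists (enorm (z - w)), w.
by move=> _ [v Kv <-]; exact: h.
Qed.

Lemma diameter_ge {R : realType} {n} {X : set 'cV[R]_n} {u w : 'cV[R]_n} :
  compact X -> X u -> X w -> enorm (u - w) <= diameter X.
Proof.
move=> cX Xu Xw; apply: ub_le_sup; last by exists (u, w).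
have cf : continuous (fun p : 'cV[R]_n * 'cV[R]_n => dotp (p.1 - p.2) (p.1 - p.2)).
  by apply: dotp_continuous; exact: sub_continuous.
have [|[a b] _ /= ab] := compact_EVT_max _ (compact_setX cX cX)
    (continuous_subspaceT cf).
  by exists (u, w).
exists (enorm (a - b)) => _ [p Xp <-].
by rewrite ler_enorm; apply: ab; rewrite inE.
Qed.

Lemma diameter_ge0 {R : realType} {n} {X : set 'cV[R]_n} :
  compact X -> X !=set0 -> 0 <= diameter X.
Proof.
move=> cX [u Xu]; apply: le_trans (diameter_ge cX Xu Xu); exact: enorm_ge0.
Qed.

(** The sign of L is not assumed.  A negative Lipschitz constant forces all
points of X to coincide, and then both sides vanish. *)
Lemma lipschitz_diameter {R : realType} {n} {X : set 'cV[R]_n} {L : R}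
    {u w : 'cV[R]_n} :
  compact X ->
  (forall u' w', X u' -> X w' -> 0 <= L * enorm (u' - w')) ->
  X u -> X w -> L * enorm (u - w) ^+ 2 <= L * diameter X ^+ 2.
Proof.
move=> cX hL Xu Xw; have [L0|L0] := leP 0 L.
  apply: ler_wpM2l => //; rewrite ler_sqr ?nnegrE ?enorm_ge0 //.
    exact: diameter_ge.
  by apply: diameter_ge0 => //; exists u.
have e0 u' w' : X u' -> X w' -> enorm (u' - w') = 0.
  move=> Xu' Xw'; apply/eqP; rewrite eq_le enorm_ge0 andbT.
  by rewrite -(ler_nM2l L0) mulr0 hL.
suff -> : diameter X = 0 by rewrite e0.
apply/eqP; rewrite eq_le diameter_ge0 ?andbT //; last by exists u.
apply: ge_sup; first by exists (enorm (u - u)), (u, u).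
by move=> _ [p [Xp1 Xp2] <-]; rewrite e0.
Qed.

(** * Projections onto convex sets *)

Lemma convex_setP {R : realType} {n} {K : set 'cV[R]_n} {u w : 'cV[R]_n} {t : R} :
  convex_set K -> K u -> K w -> 0 <= t <= 1 -> K (u + t *: (w - u)).
Proof.
move=> cK Ku Kw t01.
have := cK w u (Itv01 (proj1 (andP t01)) (proj2 (andP t01))).
rewrite !inE => /(_ Kw Ku); congr (K _).
rewrite /conv /= /unstable.onem scalerBl scale1r scalerBr.
by rewrite [LHS]addrC -addrA; congr (_ + _); rewrite addrC.
Qed.

(** The first-order condition for p to be nearest to z in K: a positive inner
product would let a short move from p towards w decrease the distance. *)
Lemma projection_obtuse {R : realType} {n} {K : set 'cV[R]_n} {z p w} :
  convex_set K -> K p -> (forall v, K v -> enorm (z - p) <= enorm (z - v)) ->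
  K w -> dotp (z - p) (w - p) <= 0.
Proof.
move=> cK Kp pmin Kw; rewrite leNgt; apply/negP => c0.
have ineq t : 0 <= t <= 1 ->
    t * (2 * dotp (z - p) (w - p)) <= t * (t * dotp (w - p) (w - p)).
  move=> t01; have := pmin _ (convex_setP cK Kp Kw t01).
  rewrite ler_enorm opprD addrA [leRHS]dotpBl !(dotpBr _ _ (t *: _)).
  by rewrite !(dotpZl, dotpZr) (dotpC (w - p) (z - p)); lra.
move: c0 ineq; set c := dotp (z - p) _; set q := dotp (w - p) _ => c0 ineq.
(* the minimizer c / q of the distance along the segment, cut off at 1 *)
have [qc|cq] := leP q c; first by have := ineq 1; rewrite lexx ler01 => /(_ isT); lra.
have q0 : 0 < q by apply: lt_trans cq.
have t0 : 0 < c / q by rewrite divr_gt0.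
have := ineq (c / q); rewrite (ltW t0) ler_pdivrMr // mul1r (ltW cq) => /(_ isT).
by rewrite ler_pM2l // divfK ?gt_eqF //; lra.
Qed.

Lemma trmx_continuous {R : realType} {n} :
  continuous (fun v : 'rV[R]_n => v^T : 'cV[R]_n).
Proof.
move=> v s /nbhs_ballP[e e0 es]; apply/nbhs_ballP; exists e => // u [_ vu].
by apply: es; split => // i j; rewrite !mxE; exact: vu.
Qed.

(** The part of K within distance ||z - k0|| of z, for some k0 in K, is compact
and has a nearest point.  The minimization runs over transposes, because
[bounded_closed_compact] is about row vectors. *)
Lemma projection_exists {R : realType} {n} {K : set 'cV[R]_n} z :
  closed K -> K !=set0 ->
  exists2 p, K p & forall v, K v -> enorm (z - p) <= enorm (z - v).
Proof.
move=> clK [k0 Kk0].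
have cg : continuous (fun v : 'rV[R]_n => dotp (z - v^T) (z - v^T)).
  have cz : continuous (fun v : 'rV[R]_n => z - v^T).
    by move=> v; exact: (cvgB (cvg_cst z) (@trmx_continuous R n v)).
  exact: dotp_continuous.
pose r := dotp (z - k0) (z - k0).
pose B := [set v : 'rV[R]_n | K v^T] `&` [set v | dotp (z - v^T) (z - v^T) <= r].
have clB : closed B.
  apply: closedI; first exact: (preimage_closed (fun v _ => @trmx_continuous R n v) clK).
  exact: (@preimage_closed _ _ _ [set x : R | x <= r] (fun v _ => cg v) (@closed_le R r)).
have bB : bounded_set B.
  exists (`|z| + Num.sqrt r); split; first exact: num_real.
  move=> M zrM v [_ /= vr]; apply: le_trans (ltW zrM).
  have M0 : 0 <= `|z| + Num.sqrt r by rewrite addr_ge0 ?sqrtr_ge0.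
  rewrite [leLHS]/Num.norm /= mx_normrE; apply/bigmax_leP; split => //= -[i j] _ /=.
  have hz : `|z j i| <= `|z|.
    rewrite [leRHS]/Num.norm /= mx_normrE; apply/bigmax_geP; right => /=.
    by exists (j, i).
  have hv : `|z j i - v i j| <= Num.sqrt r.
    rewrite -sqrtr_sqr ler_sqrt ?dotp_ge0 //; apply: le_trans vr.
    rewrite /dotp (bigD1 j) //= (ord1 i) !mxE -expr2 lerDl.
    by apply: sumr_ge0 => l _; rewrite -expr2 sqr_ge0.
  have -> : v i j = z j i - (z j i - v i j) by rewrite subKr.
  by apply: le_trans (ler_normB _ _) _; exact: lerD.
have B0 : B k0^T by split; rewrite /= trmxK.
have [|p] := compact_EVT_min _ (bounded_closed_compact bB clB)
  (continuous_subspaceT cg); first by exists k0^T.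
rewrite inE => -[Kp pr] pmin; exists p^T => // v Kv.
rewrite ler_enorm; have [vr|rv] := leP (dotp (z - v) (z - v)) r.
  have := pmin v^T; rewrite inE trmxK; apply.
  by split; rewrite /= trmxK.
exact: le_trans pr (ltW rv).
Qed.

(** * Smooth convex functions *)

Lemma edifferentiable_fineK {R : realType} {n} {f : 'cV[R]_n -> \bar R} {x} :
  edifferentiable f x -> f x = (fine (f x))%:E.
Proof. by move=> [/nbhs_singleton /fineK ->]. Qed.

(** The gradient is defined by its coordinates; linearity of the differential
extends this to every direction. *)
Lemma edifferentiable_derive {R : realType} {n} {f : 'cV[R]_n -> \bar R} {x} v :
  edifferentiable f x -> is_derive x v (fine \o f) (dotp (gradient f x) v).
Proof.
move=> [_ df]; apply: DeriveDef; first exact: diff_derivable.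
rewrite deriveE // {1}(matrix_sum_delta v) linear_sum; apply: eq_bigr => i _.
by rewrite big_ord1 linearZ mxE deriveE // /GRing.scale /= mulrC.
Qed.

(** The two difference quotients are the same function of the increment. *)
Lemma is_derive_line {R : realType} {n} {f : 'cV[R]_n -> R} {x v : 'cV[R]_n}
    {t df : R} :
  is_derive (x + t *: v) v f df ->
  is_derive t 1 (fun s : R => f (x + s *: v)) df.
Proof.
have E : (fun h : R => h^-1 *: (((fun s : R => f (x + s *: v)) \o shift t) (h *: 1)
    - f (x + t *: v))) =
    (fun h : R => h^-1 *: ((f \o shift (x + t *: v)) (h *: v) - f (x + t *: v))).
  apply/funext => h /=; congr (_ *: (f _ - _)).
  by rewrite [h *: 1]mulr1 scalerDl addrCA.
by move=> [ex dE]; split; [rewrite /derivable E | rewrite /derive E].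
Qed.

(** Convexity bounds the difference quotients at x towards y by f(y) - f(x);
let the step tend to 0 from the right. *)
Lemma gradient_le {R : realType} {n} {f : 'cV[R]_n -> \bar R} {x y} :
  (forall z, f z != -oo%E) -> convex_efun f ->
  edifferentiable f x -> edifferentiable f y ->
  dotp (gradient f x) (y - x) <= fine (f y) - fine (f x).
Proof.
move=> fNy cf dx dy; have [ex <-] := edifferentiable_derive (y - x) dx.
rewrite /derive cvg_at_rightE //; apply: limr_le.
  exact: cvgP (cvg_dnbhs_at_right ex).
near=> t.
have t0 : 0 < t by near: t; exact: nbhs_right_gt.
have t1 : t < 1 by near: t; exact: nbhs_right_lt.
have -> : (fine \o f \o shift x) (t *: (y - x)) = fine (f (t *: y + (1 - t) *: x)).
  by congr (fine (f _)) => /=; rewrite scalerBl scale1r scalerBr addrA addrAC.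
have /(cf y x) : 0 <= t <= 1 by rewrite !ltW.
rewrite (edifferentiable_fineK dx) (edifferentiable_fineK dy).
case: (f (t *: y + (1 - t) *: x)) (fNy (t *: y + (1 - t) *: x)) => // r _.
rewrite -!EFinM -EFinD lee_fin /= => H.
rewrite /GRing.scale /= mulrC ler_pdivrMr //; lra.
Unshelve. all: by end_near. Qed.

(** Only the gradients on the segment from x to y matter.  The function g below
is f along this segment minus the quadratic upper model; the Lipschitz bound
makes its derivative nonpositive, so the mean value theorem gives
g 1 <= g 0. *)
Lemma descent {R : realType} {n} {X : set 'cV[R]_n} {f : 'cV[R]_n -> \bar R} {L}
    {x y} :
  convex_set X -> smooth_on X f L -> X x -> X y ->
  fine (f y) <= fine (f x) + dotp (gradient f x) (y - x)
                + L / 2 * enorm (y - x) ^+ 2.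
Proof.
move=> cX [dX lipX] Xx Xy; pose v := y - x.
have Xt (t : R) : 0 <= t <= 1 -> X (x + t *: v) by exact: convex_setP.
pose q := L * enorm v ^+ 2; pose c := dotp (gradient f x) v.
pose g (t : R) := fine (f (x + t *: v)) - (t * c + t ^+ 2 * (q / 2)).
pose dg (t : R) := dotp (gradient f (x + t *: v)) v - (c + t * q).
have gD (t : R) : 0 <= t <= 1 -> is_derive t 1 g (dg t).
  move=> t01.
  have := is_derive_line (edifferentiable_derive v (dX _ (Xt _ t01))).
  move=> D1; apply: is_deriveB; apply: is_derive_eq.
  have scaleE (a b : R) : a *: (b : R^o) = a * b by [].
  by rewrite !scaler0 !add0r !scaleE !mulr1; field.
have gC : {within `[0, 1], continuous g}.
  apply: derivable_within_continuous => t; rewrite in_itv /= => t01.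
  by have [] := gD t t01.
have gD' (t : R) : t \in `]0, 1[%R -> is_derive t 1 g (dg t).
  by rewrite in_itv /= => /andP[t0 t1]; apply: gD; rewrite !ltW.
have [t] := MVT_segment ler01 gD' gC.
rewrite in_itv /= => t01; rewrite subr0 mulr1 /g scale0r addr0 scale1r subrKC.
rewrite mul0r expr0n mul0r addr0 subr0 mul1r expr1n mul1r.
rewrite -/v -/c => gE; suff : dg t <= 0 by rewrite -gE /q; lra.
have := lipX _ _ (Xt t t01) Xx; rewrite addrAC subrr add0r enormZ.
rewrite ger0_norm ?(proj1 (andP t01)) // => lip.
have := dotp_le_enorm (gradient f (x + t *: v) - gradient f x) v.
rewrite dotpBl -/c => cs; have := ler_wpM2r (enorm_ge0 v) lip.
by rewrite /dg /q; lra.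
Qed.

(** * The indicator function and Lagrangian duality *)

Lemma indicatorT {R : realType} {T} {K : set T} {z} : K z -> indicator R K z = 0%E.
Proof. by move=> Kz; rewrite /indicator mem_set. Qed.

Lemma indicatorF {R : realType} {T} {K : set T} {z} :
  ~ K z -> indicator R K z = +oo%E.
Proof. by move=> Kz; rewrite /indicator memNset. Qed.

Lemma indicator_closed {R : realType} {n} {K : set 'cV[R]_n} :
  lower_semicontinuous (indicator R K) -> closed K.
Proof.
move=> /lower_semicontinuousP/(_ 0) oK; rewrite -(setCK K); apply: open_closedC.
rewrite (_ : ~` K = [set x | 0%:E < indicator R K x]%E) //.
apply/seteqP; split=> z /=; first by move=> Kz; rewrite indicatorF ?ltry.
by move=> + Kz; rewrite indicatorT // ltxx.
Qed.

Lemma indicator_nonempty {R : realType} {T} {K : set T} :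
  Defs.proper (indicator R K) -> K !=set0.
Proof.
move=> [_ [z zK]]; exists z; apply: contrapT => Kz; move: zK.
by rewrite indicatorF // eqxx.
Qed.

(** For an indicator function the proximal point is a projection: outside K the
penalty is infinite, and inside it vanishes. *)
Lemma prox_indicator {R : realType} {n} {K : set 'cV[R]_n} {b : R} {z p} :
  0 < b -> K !=set0 -> is_prox (fun w => b%:E * indicator R K w)%E z p ->
  K p /\ forall w, K w -> enorm (z - p) <= enorm (z - w).
Proof.
move=> b0 [k Kk] [_ pmin].
have Kp : K p.
  apply: contrapT => Kp; have := pmin k I.
  by rewrite (indicatorF Kp) (indicatorT Kk) gt0_muley ?lte_fin // mule0 add0e.
split=> // w Kw; have := pmin w I.
rewrite !indicatorT // mule0 !add0e lee_fin ler_pM2l ?invr_gt0 //.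
by rewrite ler_sqr ?nnegrE ?enorm_ge0 // !(enormB z).
Qed.

Lemma conjugate_indicator_ge {R : realType} {d} {K : set 'cV[R]_d} y {v} :
  K v -> ((dotp y v)%:E <= conjugate (indicator R K) y)%E.
Proof.
by move=> Kv; apply: ereal_sup_ubound; exists v => //; rewrite indicatorT // sube0.
Qed.

Lemma conjugate_indicator_le {R : realType} {d} {K : set 'cV[R]_d} {y} {c : R} :
  (forall v, K v -> dotp y v <= c) -> (conjugate (indicator R K) y <= c%:E)%E.
Proof.
move=> h; apply: ge_ereal_sup => _ [v _ <-]; have [Kv|Kv] := pselect (K v).
  by rewrite indicatorT // sube0 lee_fin h.
by rewrite indicatorF // addeNy leNye.
Qed.

(** The inequality g** >= g for the indicator of K.  If Ax is in K, the
multiplier y = 0 suffices.  Otherwise let p be the projection of Ax and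
u = Ax - p: the multiplier t u gives at least f(x) + t ||u||^2, which is
unbounded in t. *)
Lemma objective_le_sup_lagrangian {R : realType} {d n} {f : 'cV[R]_n -> \bar R}
    {K : set 'cV[R]_d} {A : 'M[R]_(d, n)} {x : 'cV[R]_n} :
  closed K -> convex_set K -> K !=set0 -> f x \is a fin_num ->
  (objective f (indicator R K) A x
     <= ereal_sup (range (lagrangian f (indicator R K) A x)))%E.
Proof.
move=> clK cK K0 /fineK fx; rewrite /objective.
have supL y c : (forall v, K v -> dotp y v <= c) ->
    ((fine (f x) + dotp y (A *m x) - c)%:E
       <= ereal_sup (range (lagrangian f (indicator R K) A x)))%E.
  move=> /conjugate_indicator_le hc.
  apply: (@le_trans _ _ (lagrangian f (indicator R K) A x y)); last first.
    by apply: ereal_sup_ubound; exists y.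
  by rewrite /lagrangian -fx /= EFinB EFinD; apply: leeB.
have [KAx|KAx] := pselect (K (A *m x)).
  have := supL 0 0; rewrite indicatorT // adde0 dotp0l addr0 subr0 fx; apply.
  by move=> v _; rewrite dotp0l.
have [p Kp pmin] := projection_exists (A *m x) clK K0.
set u := A *m x - p in pmin.
have u0 : 0 < dotp u u.
  rewrite lt_neqAle dotp_ge0 andbT eq_sym; apply/eqP => /dotp_eq0/eqP.
  by rewrite subr_eq0 => /eqP AxE; apply: KAx; rewrite AxE.
rewrite indicatorF // addey; last by rewrite -fx.
rewrite leye_eq; apply/eqP/eq_infty => r.
(* this choice of t makes t ||u||^2 equal to |r - f(x)|, enough to reach r *)
pose t := `|r - fine (f x)| / dotp u u.
have t0 : 0 <= t by rewrite divr_ge0 // dotp_ge0.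
apply: le_trans (supL (t *: u) (t * dotp u p) _); last first.
  move=> v Kv; rewrite dotpZl ler_wpM2l //.
  by have := projection_obtuse cK Kp pmin Kv; rewrite dotpBr subr_le0.
rewrite lee_fin dotpZl -addrA -mulrBr -dotpBr -/u divfK ?gt_eqF //.
by rewrite -lerBlDl ler_norm.
Qed.

(** The optimal dual value is at least the primal one, by duality and
[objective_le_sup_lagrangian], and at most the Lagrangian at (x, ystar), in
which the conjugate at ystar is at least <ystar, v> for each v in K.  The
Lagrangian at a point of X is below +oo, so the primal value is finite, which
is why xstar is feasible. *)
Lemma saddle_point {R : realType} {d n} {X : set 'cV[R]_n} {f : 'cV[R]_n -> \bar R}
    {K : set 'cV[R]_d} {A : 'M[R]_(d, n)} {xstar ystar} :
  (forall x, X x -> f x \is a fin_num) ->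
  closed K -> convex_set K -> K !=set0 ->
  is_argmin X (objective f (indicator R K) A) xstar ->
  strong_duality X f (indicator R K) A ->
  is_argmax setT (dual_function X f (indicator R K) A) ystar ->
  K (A *m xstar) /\
  forall x v, X x -> K v ->
    dotp ystar (v - A *m x) <= fine (f x) - fine (f xstar).
Proof.
move=> fX clK cK [k Kk] [Xs smin] dual [_ ymax].
have key x v : X x -> K v ->
    (objective f (indicator R K) A xstar
       <= (fine (f x) + dotp ystar (A *m x) - dotp ystar v)%:E)%E.
  move=> Xx Kv.
  apply: (@le_trans _ _ (dual_function X f (indicator R K) A ystar)); last first.
    apply: (@le_trans _ _ (lagrangian f (indicator R K) A x ystar)).
      by apply: ereal_inf_lbound; exists x.
    rewrite /lagrangian EFinB EFinD fineK ?fX //.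
    by apply: leeB => //; exact: conjugate_indicator_ge.
  apply: (@le_trans _ _ (ereal_sup (range (dual_function X f (indicator R K) A)))).
    rewrite dual; apply: le_ereal_inf_tmp => _ [w Xw <-].
    apply: le_trans (smin w Xw) _; apply: objective_le_sup_lagrangian => //.
      by exists k.
    exact: fX.
  by apply: ge_ereal_sup => _ [y _ <-]; exact: ymax.
have KAs : K (A *m xstar).
  apply: contrapT => KAs; have := key xstar k Xs Kk.
  by rewrite /objective indicatorF // -(fineK (fX _ Xs)).
split=> // x v Xx Kv; have := key x v Xx Kv.
rewrite /objective indicatorT // adde0 -(fineK (fX _ Xs)) lee_fin /=.
by rewrite dotpBr; lra.
Qed.

(** * One step of the algorithm *)

Lemma sqr_enormDZ {R : realType} {n} (u w : 'cV[R]_n) (t : R) :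
  enorm (u + t *: w) ^+ 2 = dotp u u + 2 * t * dotp u w + t ^+ 2 * dotp w w.
Proof.
by rewrite sqr_enorm !(dotpDl, dotpDr, dotpZl, dotpZr) (dotpC w u); ring.
Qed.

(** Frank-Wolfe step on f + dist(A ., K)^2 / (2 b), multiplied by 2 b.  The
linearized penalty contributes -2 dist^2 instead of -dist^2, whence the weight
1 - 2 eta, because the comparison point A xstar lies in K. *)
Lemma smoothed_gap_step {R : realType} {d n} {X : set 'cV[R]_n}
    {f : 'cV[R]_n -> \bar R} {Lf : R} {K : set 'cV[R]_d} {A : 'M[R]_(d, n)}
    {xstar x s : 'cV[R]_n} {p : 'cV[R]_d} {b eta : R} :
  compact X -> convex_set X ->
  (forall z, f z != -oo%E) -> convex_efun f -> smooth_on X f Lf ->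
  convex_set K -> X xstar -> K (A *m xstar) -> X x -> K p ->
  (forall w, K w -> enorm (A *m x - p) <= enorm (A *m x - w)) ->
  is_argmin X (dotp (b *: gradient f x + A^T *m (A *m x - p))) s ->
  0 < b -> (0 <= eta <= 1) ->
  2 * b * (fine (f (x + eta *: (s - x))) - fine (f xstar))
    + dist (A *m (x + eta *: (s - x))) K ^+ 2 <=
    2 * b * ((1 - eta) * (fine (f x) - fine (f xstar)))
    + (1 - 2 * eta) * dist (A *m x) K ^+ 2
    + eta ^+ 2 * (Lf * diameter X ^+ 2 * b
                  + spectral_norm A ^+ 2 * diameter X ^+ 2).
Proof.
move=> cX convX fNy cf smooth cK Xs KAs Xx Kp pmin [Xm smin] b0 eta01.
set x' := x + eta *: (s - x); pose gap z := fine (f z) - fine (f xstar).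
rewrite -/(gap x') -/(gap x).
have [dX lipX] := smooth.
have /andP[eta0 _] := eta01.
have Xx' : X x' by exact: convex_setP.
(* u is opaque, so that expanding inner products by bilinearity stops at it *)
have [u uE] : exists u, A *m x - p = u by eexists.
rewrite uE in smin.
have distx : dist (A *m x) K ^+ 2 = dotp u u.
  rewrite -uE -sqr_enorm; congr (_ ^+ 2); apply/eqP; rewrite eq_le dist_le //=.
  by apply: dist_ge => //; exists p.
set c := dotp (gradient f x) (s - x); set e := dotp u (A *m (s - x)).
have fx' : fine (f x') <= fine (f x) + eta * c
    + eta ^+ 2 / 2 * (Lf * diameter X ^+ 2).
  apply: le_trans (descent convX smooth Xx Xx') _.
  rewrite /x' [x + _ - x]addrAC subrr add0r dotpZr enormZ (ger0_norm eta0).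
  have L0 w w' : X w -> X w' -> 0 <= Lf * enorm (w - w').
    by move=> Xw Xw'; apply: le_trans (lipX w w' Xw Xw'); exact: enorm_ge0.
  have := lipschitz_diameter cX L0 Xm Xx.
  by have := sqr_ge0 eta; rewrite /c; nra.
have dx' : dist (A *m x') K ^+ 2 <= dotp u u + 2 * eta * e
    + eta ^+ 2 * (spectral_norm A ^+ 2 * diameter X ^+ 2).
  apply: (@le_trans _ _ (enorm (A *m x' - p) ^+ 2)).
    rewrite ler_sqr ?nnegrE ?enorm_ge0 ?dist_le //.
    by apply: dist_ge; [exists p | move=> w _; exact: enorm_ge0].
  have -> : A *m x' - p = u + eta *: (A *m (s - x)).
    by rewrite -uE /x' mulmxDr scalemxAr addrAC.
  have ADs : dotp (A *m (s - x)) (A *m (s - x))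
      <= spectral_norm A ^+ 2 * diameter X ^+ 2.
    rewrite -sqr_enorm -exprMn ler_sqr ?nnegrE ?enorm_ge0 //; last first.
      by rewrite mulr_ge0 ?spectral_norm_ge0 ?diameter_ge0 //; exists x.
    apply: le_trans (enorm_mulmx A _) _.
    by rewrite ler_wpM2l ?spectral_norm_ge0 // diameter_ge.
  rewrite sqr_enormDZ -/e.
  by have := sqr_ge0 eta; nra.
(* the linear model at s is at most the linear model at xstar *)
have lmo : b * c + e <= b * - gap x - dotp u u.
  have := smin _ Xs; rewrite !dotpDl !dotpZl !dotp_trmx => opt.
  have := gradient_le fNy cf (dX _ Xx) (dX _ Xs).
  rewrite dotpBr => /(ler_wpM2l (ltW b0)).
  have := projection_obtuse cK Kp pmin KAs.
  have -> : A *m xstar - p = A *m xstar - A *m x + u by rewrite -uE addrA subrK.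
  rewrite uE dotpDr dotpBr /gap /c /e mulmxBr !dotpBr.
  by move=> *; lra.
rewrite distx /gap in lmo *.
by nra.
Qed.

(** * Convergence rate *)

(** Numerical inequalities for r = sqrt k and q = sqrt (k+1).  The first one
absorbs the change of penalty parameter, (1 - 2 eta_k) / beta_k <=
(1 - eta_k) / beta_{k-1}; the other two say that the sequences 1 / k and
1 / sqrt k dominate the recursion with factor 1 - eta_k and source terms
eta_k^2 / 4 and sqrt (k+1) eta_k^2 / 4, respectively. *)
Lemma step_weights {R : realType} {r q : R} : 1 <= r -> 0 < q -> q ^+ 2 = r ^+ 2 + 1 ->
  [/\ (1 - 2 * (2 / q ^+ 2)) * q <= (1 - 2 / q ^+ 2) * r,
      (1 - 2 / q ^+ 2) / r ^+ 2 + (q ^+ 2)^-1 ^+ 2 <= (q ^+ 2)^-1 &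
      (1 - 2 / q ^+ 2) / r + (q ^+ 3)^-1 <= q^-1].
Proof.
move=> r1 q0 qr; have r0 : 0 < r by lra.
have r21 : 1 <= r ^+ 2 by rewrite expr_ge1 // ltW.
have q20 : 0 < q ^+ 2 by rewrite exprn_gt0.
split.
- rewrite -subr_ge0.
  have -> : (1 - 2 / q ^+ 2) * r - (1 - 2 * (2 / q ^+ 2)) * q =
     ((r ^+ 2 - 1) * r - (r ^+ 2 - 3) * q) / q ^+ 2.
    apply: (canRL (mulfK _)); first by rewrite gt_eqF.
    by rewrite -[r ^+ 2](addrK 1) -qr; field; rewrite gt_eqF.
  apply: divr_ge0; last exact: ltW.
  rewrite subr_ge0.
  (* for k <= 3 the left-hand side is nonpositive; otherwise compare squares *)
  have [r23|r23] := leP (r ^+ 2) 3.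
    apply: (@le_trans _ _ 0); last by rewrite mulr_ge0; lra.
    by apply: mulr_le0_ge0; lra.
  rewrite -ler_sqr ?nnegrE; last 2 first.
  - by rewrite mulr_ge0; lra.
  - by rewrite mulr_ge0; lra.
  by rewrite !exprMn qr; move: r23; set c := r ^+ 2; nra.
- rewrite -subr_ge0.
  have -> : (q ^+ 2)^-1 - ((1 - 2 / q ^+ 2) / r ^+ 2 + (q ^+ 2)^-1 ^+ 2) =
      (r ^+ 2 * q ^+ 2 ^+ 2)^-1.
    by rewrite qr; field; rewrite !gt_eqF //; lra.
  by rewrite invr_ge0 mulr_ge0 ?sqr_ge0.
- rewrite -subr_ge0.
  have -> : q^-1 - ((1 - 2 / q ^+ 2) / r + (q ^+ 3)^-1) =
     (r ^+ 3 - (r ^+ 2 - 1) * q) / (r * q ^+ 3).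
    rewrite exprS.
    have -> : (r ^+ 2 - 1) = (q ^+ 2 - 2) by rewrite qr; ring.
    have -> : r ^+ 3 = r * (q ^+ 2 - 1) by rewrite qr; ring.
    by field; rewrite !gt_eqF.
  rewrite divr_ge0 //; last by rewrite mulr_ge0 ?exprn_ge0 // ltW.
  rewrite subr_ge0 -ler_sqr ?nnegrE; last 2 first.
  - by rewrite mulr_ge0; lra.
  - by rewrite exprn_ge0 // ltW.
  by rewrite exprMn qr exprAC; move: r21; set c := r ^+ 2; nra.
Qed.

(** Induction on k for S_k = F k + delta_k^2 / (2 beta_{k-1}).  There is no base
case to check at k = 2: the weight 1 - eta_1 of S_1 is zero, so the arbitrary
S_1 drops out of the recursion. *)
Lemma smoothed_gap_rate {R : realType} (F delta : nat -> R) (l a b0 : R) :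
  0 <= l -> 0 <= a -> 0 < b0 ->
  (forall k, (1 <= k)%N ->
    2 * (b0 / Num.sqrt k.+1%:R) * F k.+1 + delta k.+1 ^+ 2 <=
      2 * (b0 / Num.sqrt k.+1%:R) * ((1 - 2 / k.+1%:R) * F k)
      + (1 - 2 * (2 / k.+1%:R)) * delta k ^+ 2
      + (2 / k.+1%:R) ^+ 2 * (l * (b0 / Num.sqrt k.+1%:R) + a)) ->
  forall k, (2 <= k)%N ->
    F k + delta k ^+ 2 * Num.sqrt k%:R / (2 * b0)
      <= 2 * (l / k%:R + a / (b0 * Num.sqrt k%:R)).
Proof.
move=> l0 a0 b0_gt0 step.
have main k : (1 <= k)%N ->
    (1 - 2 / k.+1%:R) * (F k + delta k ^+ 2 * Num.sqrt k%:R / (2 * b0))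
      <= (1 - 2 / k.+1%:R) * (2 * (l / k%:R + a / (b0 * Num.sqrt k%:R))) ->
    F k.+1 + delta k.+1 ^+ 2 * Num.sqrt k.+1%:R / (2 * b0)
      <= 2 * (l / k.+1%:R + a / (b0 * Num.sqrt k.+1%:R)).
  move=> k1 IH.
  have := step k k1.
  have : 1 <= Num.sqrt (k%:R : R) by rewrite -[leLHS]sqrtr1 ler_sqrt ?ler1n ?ler0n.
  have : 0 < Num.sqrt (k.+1%:R : R) by rewrite sqrtr_gt0 ltr0n.
  have : Num.sqrt (k.+1%:R : R) ^+ 2 = Num.sqrt (k%:R : R) ^+ 2 + 1.
    by rewrite !sqr_sqrtr // natr1.
  have {IH} : (1 - 2 / Num.sqrt k.+1%:R ^+ 2)
      * (F k + delta k ^+ 2 * Num.sqrt k%:R / (2 * b0))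
    <= (1 - 2 / Num.sqrt k.+1%:R ^+ 2)
      * (2 * (l / Num.sqrt k%:R ^+ 2 + a / (b0 * Num.sqrt k%:R))).
    by rewrite !sqr_sqrtr.
  set q := Num.sqrt k.+1%:R; set r := Num.sqrt k%:R.
  have <- : q ^+ 2 = k.+1%:R by rewrite sqr_sqrtr.
  move: q r => q r IH qr q0 r1 H.
  have r0 : 0 < r by lra.
  have [N1 N2 N3] := step_weights r1 q0 qr.
  have q2b : 0 <= q / (2 * b0) by rewrite divr_ge0 ?mulr_ge0 // ltW.
  have b2 : 0 <= (2 * b0)^-1 by rewrite invr_ge0 mulr_ge0 // ltW.
  have {}H := ler_wpM2r q2b H.
  have {}N1 := ler_wpM2l (mulr_ge0 (sqr_ge0 (delta k)) b2) N1.
  have {}N2 := ler_wpM2l (mulr_ge0 (ler0n R 2) l0) N2.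
  have ab : 0 <= 2 * (a / b0) by rewrite mulr_ge0 // divr_ge0 // ltW.
  have {}N3 := ler_wpM2l ab N3.
  (* the step, multiplied by q / (2 b0), in terms of the three weights *)
  have E1 : (2 * (b0 / q) * F k.+1 + delta k.+1 ^+ 2) * (q / (2 * b0))
      = F k.+1 + delta k.+1 ^+ 2 * q / (2 * b0).
    by field; rewrite !gt_eqF.
  have E2 : (2 * (b0 / q) * ((1 - 2 / q ^+ 2) * F k)
      + (1 - 2 * (2 / q ^+ 2)) * delta k ^+ 2
      + (2 / q ^+ 2) ^+ 2 * (l * (b0 / q) + a)) * (q / (2 * b0))
      = (1 - 2 / q ^+ 2) * F k
        + delta k ^+ 2 * (2 * b0)^-1 * ((1 - 2 * (2 / q ^+ 2)) * q)
        + 2 * l * (q ^+ 2)^-1 ^+ 2 + 2 * (a / b0) * (q ^+ 3)^-1.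
    by field; rewrite !gt_eqF.
  have E3 : (1 - 2 / q ^+ 2) * (F k + delta k ^+ 2 * r / (2 * b0))
      = (1 - 2 / q ^+ 2) * F k
        + delta k ^+ 2 * (2 * b0)^-1 * ((1 - 2 / q ^+ 2) * r).
    by field; rewrite !gt_eqF.
  have E4 : (1 - 2 / q ^+ 2) * (2 * (l / r ^+ 2 + a / (b0 * r)))
      = 2 * l * ((1 - 2 / q ^+ 2) / r ^+ 2)
        + 2 * (a / b0) * ((1 - 2 / q ^+ 2) / r).
    by field; rewrite !gt_eqF.
  have E5 : 2 * (l / q ^+ 2 + a / (b0 * q))
      = 2 * l * (q ^+ 2)^-1 + 2 * (a / b0) * q^-1.
    by field; rewrite !gt_eqF.
  move: H IH N1 N2 N3; rewrite E1 E2 E3 E4 E5 !mulrDr.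
  by move=> *; lra.
move=> [//|[//|k]] _; elim: k => [|k IH].
  apply: main => //.
  by rewrite divff ?pnatr_eq0 // subrr !mul0r.
apply: main => //; apply: ler_wpM2l IH.
by rewrite subr_ge0 ler_pdivrMr ?ltr0n // mul1r ler_nat.
Qed.

(** The larger root of the quadratic is e y + sqrt (e^2 y^2 + 4 e^2 w^2), at most
2 e y + 2 e w. *)
Lemma quadratic_distance_bound {R : realType} (dl e y w : R) :
  0 <= e -> 0 <= y -> 0 <= w ->
  dl ^+ 2 <= 2 * e * y * dl + 4 * e ^+ 2 * w ^+ 2 ->
  dl <= 2 * e * (y + w).
Proof.
move=> e0 y0 w0; apply: contraTT; rewrite -!ltNge => h.
have ew : 0 <= e * w by exact: mulr_ge0.
have ey : 0 <= e * y by exact: mulr_ge0.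
by nra.
Qed.

(** Each iterate is a convex combination of two points of X, since
2 / (k+1) <= 1 for k >= 1. *)
Lemma composite_cg_mem {R : realType} {d n} {X : set 'cV[R]_n}
    {f : 'cV[R]_n -> \bar R} {g : 'cV[R]_d -> \bar R} {A : 'M[R]_(d, n)}
    {beta0 : R} {x : nat -> 'cV[R]_n} k :
  convex_set X -> composite_cg X f g A beta0 x -> (1 <= k)%N -> X (x k).
Proof.
move=> convX [X1 cg]; elim: k => [//|[//|k] IH] _.
have [p [s [_ [Xs _] ->]]] := cg k.+1 isT; apply: convex_setP => //; first exact: IH.
by rewrite divr_ge0 //= ler_pdivrMr ?ltr0n // mul1r ler_nat.
Qed.

Theorem theorem3p3 (R : realType) (n d : nat)
    (X : set 'cV[R]_n) (f : 'cV[R]_n -> \bar R) (Lf : R)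
    (g : 'cV[R]_d -> \bar R) (K : set 'cV[R]_d) (A : 'M[R]_(d, n))
    (xstar : 'cV[R]_n) (ystar : 'cV[R]_d)
    (beta0 : R) (x : nat -> 'cV[R]_n)
    (X_nonempty : X !=set0) (X_compact : compact X) (X_convex : convex_set X)
    (f_pcc : proper_closed_convex f) (f_smooth : smooth_on X f Lf)
    (g_pcc : proper_closed_convex g)
    (K_convex : convex_set K) (g_indicator : g = indicator R K)
    (xstar_min : is_argmin X (objective f g A) xstar)
    (duality : strong_duality X f g A)
    (ystar_max : is_argmax setT (dual_function X f g A) ystar)
    (beta0_gt0 : 0 < beta0)
    (x_cg : composite_cg X f g A beta0 x) :
  let D := diameter X in
  let C0 := Lf + spectral_norm A ^+ 2 / beta0 in
  forall k : nat, (1 <= k)%N ->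
    [/\ ((- (enorm ystar * dist (A *m x k) K))%:E <= f (x k) - f xstar)%E,
        (* the arbitrary starting point x 1 need not satisfy this bound *)
        (2 <= k)%N ->
        (f (x k) - f xstar <=
         (2 * D ^+ 2 * (Lf / k%:R
            + spectral_norm A ^+ 2 / (beta0 * Num.sqrt k%:R)))%:E)%E &
        dist (A *m x k) K <=
          2 * beta0 / Num.sqrt k%:R * (enorm ystar + D * Num.sqrt (C0 / beta0))].
Proof.
move=> D C0 k k1; subst g.
have [[fNy _] _ f_convex] := f_pcc; have [f_diff f_lip] := f_smooth.
have fX z : X z -> f z = (fine (f z))%:E.
  by move=> Xz; exact: edifferentiable_fineK (f_diff _ Xz).
have K_closed : closed K.
  by apply: indicator_closed; case: g_pcc.
have K0 : K !=set0.
  by case: g_pcc => /indicator_nonempty.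
have Xs : X xstar by case: xstar_min.
have Xx j : (1 <= j)%N -> X (x j).
  by move=> j1; exact: (composite_cg_mem X_convex x_cg j1).
have [KAs saddle] : K (A *m xstar) /\ forall z v, X z -> K v ->
    dotp ystar (v - A *m z) <= fine (f z) - fine (f xstar).
  apply: saddle_point => // z Xz; by rewrite fX.
pose F j := fine (f (x j)) - fine (f xstar).
pose delta j := dist (A *m x j) K.
have delta_ge0 j : 0 <= delta j.
  by apply: dist_ge => // w _; exact: enorm_ge0.
have gap_ge j : (1 <= j)%N -> - (enorm ystar * delta j) <= F j.
  move=> j1; rewrite lerNl.
  have cs v : K v -> - F j <= enorm ystar * enorm (A *m x j - v).
    move=> Kv; have := saddle _ _ (Xx _ j1) Kv.
    have := dotp_le_enorm ystar (A *m x j - v).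
    by rewrite /F !dotpBr; lra.
  have [y0|y0] := eqVneq (enorm ystar) 0.
    by have [v Kv] := K0; have := cs v Kv; rewrite y0 !mul0r.
  have y_gt0 : 0 < enorm ystar by rewrite lt_neqAle eq_sym y0 enorm_ge0.
  rewrite mulrC -ler_pdivrMr //; apply: dist_ge => // v Kv.
  by rewrite ler_pdivrMr // mulrC; exact: cs.
have D0 : 0 <= D by exact: diameter_ge0.
pose l := Lf * D ^+ 2; pose a := spectral_norm A ^+ 2 * D ^+ 2.
have l0 : 0 <= l.
  have hL u v : X u -> X v -> 0 <= Lf * enorm (u - v).
    by move=> Xu Xv; apply: le_trans (f_lip _ _ Xu Xv); exact: enorm_ge0.
  apply: le_trans (lipschitz_diameter X_compact hL Xs Xs).
  by rewrite subrr enorm0 expr0n mulr0.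
have a0 : 0 <= a by rewrite mulr_ge0 ?sqr_ge0.
have rate j : (2 <= j)%N -> F j + delta j ^+ 2 * Num.sqrt j%:R / (2 * beta0)
    <= 2 * (l / j%:R + a / (beta0 * Num.sqrt j%:R)).
  apply: smoothed_gap_rate => // i i1.
  have b0 : 0 < beta0 / Num.sqrt i.+1%:R by rewrite divr_gt0 // sqrtr_gt0 ltr0n.
  have [_ /(_ i i1) /= [p [s [prox_p lmo_s xE]]]] := x_cg.
  have [Kp pmin] := prox_indicator b0 K0 prox_p.
  have eta01 : 0 <= (2 / i.+1%:R : R) <= 1.
    by rewrite divr_ge0 //= ler_pdivrMr ?ltr0n // mul1r ler_nat.
  rewrite /F /delta xE.
  exact: (smoothed_gap_step X_compact X_convex fNy f_convex f_smooth K_convex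
    Xs KAs (Xx i i1) Kp pmin lmo_s b0 eta01).
have sqrtk : 1 <= Num.sqrt k%:R :> R.
  by rewrite -[leLHS]sqrtr1 ler_sqrt ?ler1n ?ler0n.
pose w := D * Num.sqrt (C0 / beta0).
have w0 : 0 <= w by rewrite mulr_ge0 ?sqrtr_ge0.
(* equality holds if C0 >= 0; if C0 < 0 then the left-hand side is nonpositive *)
have w2 : beta0 * l + a <= beta0 ^+ 2 * w ^+ 2.
  have -> : beta0 * l + a = beta0 ^+ 2 * (D ^+ 2 * (C0 / beta0)).
    by rewrite /l /a /C0; field; rewrite gt_eqF.
  rewrite /w exprMn; apply: ler_wpM2l; first exact: sqr_ge0.
  apply: ler_wpM2l; first exact: sqr_ge0.
  have [c0|c0] := leP 0 (C0 / beta0); first by rewrite sqr_sqrtr.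
  by apply: le_trans (ltW c0) _; exact: sqr_ge0.
have y0 := enorm_ge0 ystar.
split.
- rewrite (fX _ Xs) (fX _ (Xx _ k1)) -EFinB lee_fin; exact: gap_ge.
- move=> k2; rewrite (fX _ Xs) (fX _ (Xx _ k1)) -EFinB lee_fin.
  apply: le_trans (le_trans _ (rate k k2)) _; first rewrite lerDl.
    by rewrite divr_ge0 ?mulr_ge0 ?sqr_ge0 ?sqrtr_ge0 // ltW.
  rewrite le_eqVlt; apply/orP; left; apply/eqP; rewrite /l /a; ring.
- rewrite -/w -[dist _ _]/(delta k) -(mulrA 2).
  have e0 : 0 < beta0 / Num.sqrt k%:R by rewrite divr_gt0 // (lt_le_trans _ sqrtk).
  have [k_le1|k2] := leqP k 1.
    have -> : k = 1%N by apply/eqP; rewrite eqn_leq k_le1.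
    (* the recursion says nothing about x 1, only that it lies in X with xstar *)
    have d1 : delta 1%N <= spectral_norm A * D.
      apply: le_trans (dist_le _ KAs) _; rewrite -mulmxBr.
      apply: le_trans (enorm_mulmx A _) _.
      by rewrite ler_wpM2l ?spectral_norm_ge0 // diameter_ge //; exact: Xx.
    have AD0 : 0 <= spectral_norm A * D by rewrite mulr_ge0 ?spectral_norm_ge0.
    have AD : spectral_norm A * D <= beta0 * w.
      rewrite -ler_sqr ?nnegrE // ?mulr_ge0 ?(ltW beta0_gt0) //.
      rewrite [leLHS]exprMn [leRHS]exprMn.
      apply: le_trans w2; rewrite -/a lerDr mulr_ge0 // ltW //.
    have by0 : 0 <= beta0 * enorm ystar by rewrite mulr_ge0 // ltW.
    have bw0 : 0 <= beta0 * w by rewrite mulr_ge0 // ltW.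
    by rewrite sqrtr1 divr1; lra.
  apply: quadratic_distance_bound => //; first exact: ltW.
  have := rate k k2; have := gap_ge k k1.
  have : k%:R = Num.sqrt k%:R ^+ 2 :> R by rewrite sqr_sqrtr.
  move: sqrtk e0; set r := Num.sqrt k%:R => r1 e0 -> lb ub.
  have r0 : 0 < r by lra.
  have e2 : 0 <= (beta0 / r) ^+ 2 / beta0 ^+ 2 by rewrite divr_ge0 ?sqr_ge0.
  have {}ub := ler_wpM2r (mulr_ge0 (ler0n R 2) (ltW e0)) ub.
  have {}lb := ler_wpM2r (mulr_ge0 (ler0n R 2) (ltW e0)) lb.
  have {}w2 := ler_wpM2l e2 w2.
  (* here 1 / k is weakened to 1 / sqrt k, to merge both terms into C0 *)
  have lr : l / r ^+ 2 <= l / r.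
    by rewrite ler_wpM2l // lef_pV2 ?posrE ?exprn_gt0 // expr2 ler_peMr // ltW.
  have {}lr := ler_wpM2r (mulr_ge0 (ler0n R 4) (ltW e0)) lr.
  have E1 : (F k + delta k ^+ 2 * r / (2 * beta0)) * (2 * (beta0 / r))
      = F k * (2 * (beta0 / r)) + delta k ^+ 2.
    by field; rewrite !gt_eqF.
  have E2 : 2 * (l / r ^+ 2 + a / (beta0 * r)) * (2 * (beta0 / r))
      = l / r ^+ 2 * (4 * (beta0 / r)) + 4 * a / r ^+ 2.
    by field; rewrite !gt_eqF.
  have E3 : (beta0 / r) ^+ 2 / beta0 ^+ 2 * (beta0 * l + a)
      = l / r * (beta0 / r) + a / r ^+ 2.
    by field; rewrite !gt_eqF.
  have E4 : (beta0 / r) ^+ 2 / beta0 ^+ 2 * (beta0 ^+ 2 * w ^+ 2)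
      = (beta0 / r) ^+ 2 * w ^+ 2.
    by field; rewrite !gt_eqF.
  by rewrite E1 E2 in ub; rewrite E3 E4 in w2; lra.
Qed.
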